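(* For every $n\ge 1$, the set of permutations of size $n$ sortable by a deque equals the set of permutations of size $n$ sortable by the shuffle queue $\mathbb{Q}_{\mathrm{rev}}$, i.e. $S_n(\mathrm{Deq}) = S_n(\mathbb{Q}_{\mathrm{rev}})$ for every $n\ge 1$.
   Context: Permutations of size $n$ are bijections of $[n]=\{1,\dots,n\}$, written in one-line notation; $S_n$ is the set of all of them, $id_n=12\cdots n$, and $\varepsilon$ is the empty sequence. A sorting device processes configurations $(s_{inp},s_{dev},s_{out})$ of three sequences (current input, content of the device, output), starting from $(\pi,\varepsilon,\varepsilon)$ and ending at $(\varepsilon,\varepsilon,\pi')$; $\pi'$ is then called a possible output on input $\pi$. For a device $\mathbb{D}$, $S_n(\mathbb{D})$ is the set of $\pi\in S_n$ for which $id_n$ is a possible output on input $\pi$ (the operations are chosen freely). Deque ($\mathrm{Deq}$): the content is a list with two ends, front and back. The operations are: $I$ (remove the first element of the input and insert it at the back of the list), $\overline{I}$ (remove the first element of the input and insert it at the front), $O$ (remove the front element of the list and append it to the end of the output), $\overline{O}$ (remove the back element of the list and append it to the end of the output). Shuffle queue $\mathbb{Q}_{\mathrm{rev}}$: the operations are: push (move the first element of the input to the end of $s_{dev}$), pop (move the first element of $s_{dev}$ to the end of the output), and shuffle, which replaces the content $s_{dev}$ (of length at least $2$) by its reverse. A shuffle may not be applied immediately after another shuffle. *)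

(* Defs.v *)
From HB Require Import structures.
From mathcomp Require Import all_boot all_fingroup.
From mathcomp Require Import classical_sets.

Set Implicit Arguments.
Unset Strict Implicit.
Unset Printing Implicit Defensive.

Local Open Scope classical_set_scope.

(* A configuration (s_inp, s_dev, s_out). The first element of each sequence
   is its head; the front of a deque is the head of s_dev. *)
Definition config : Type := (seq nat * seq nat * seq nat)%type.

(* [step a c = None] means that the operation [a] cannot be applied to [c];
   [admissible] expresses constraints on the order of operations that do not
   depend on the configuration alone. *)
Record device := Device {
  operation : Type;
  step : operation -> config -> option config;
  admissible : seq operation -> bool
}.

Fixpoint run (D : device) (w : seq (operation D)) (c : config)
    : option config :=
  if w is a :: w' then
    if step a c is Some c' then run w' c' else None
  else Some c.

Definition possible_output (D : device) (u v : seq nat) : Prop :=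
  exists w : seq (operation D),
    admissible w /\ run w (u, [::], [::]) = Some ([::], [::], v).

(* 'I_n is {0, ..., n-1}; entries are shifted so that words are over
   {1, ..., n}. *)
Definition one_line (n : nat) (s : 'S_n) : seq nat :=
  [seq (s i : nat).+1 | i <- enum 'I_n].

Definition sortable (n : nat) (D : device) : set 'S_n :=
  [set s : 'S_n | possible_output D (one_line s) (one_line (1%g : 'S_n))].
Arguments sortable : clear implicits.

Inductive deque_op :=
  | PushBack   (* I *)
  | PushFront  (* I-bar *)
  | PopFront   (* O *)
  | PopBack.   (* O-bar *)

Definition deque_step (a : deque_op) (c : config) : option config :=
  let: (inp, dev, out) := c in
  match a with
  | PushBack =>
      if inp is x :: inp' then Some (inp', rcons dev x, out) else None
  | PushFront =>
      if inp is x :: inp' then Some (inp', x :: dev, out) else None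
  | PopFront =>
      if dev is x :: dev' then Some (inp, dev', rcons out x) else None
  | PopBack =>
      if dev is x :: dev' then Some (inp, belast x dev', rcons out (last x dev'))
      else None
  end.

Definition Deq : device :=
  {| operation := deque_op; step := deque_step; admissible := xpredT |}.

Inductive shuffle_queue_op := Push | Pop | Shuffle.

Definition rev_queue_step (a : shuffle_queue_op) (c : config)
    : option config :=
  let: (inp, dev, out) := c in
  match a with
  | Push =>
      if inp is x :: inp' then Some (inp', rcons dev x, out) else None
  | Pop =>
      if dev is x :: dev' then Some (inp, dev', rcons out x) else None
  | Shuffle =>
      if 2 <= size dev then Some (inp, rev dev, out) else None
  end.

Definition not_both_shuffle (a b : shuffle_queue_op) : bool :=
  match a, b with Shuffle, Shuffle => false | _, _ => true end.

Definition Qrev : device :=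
  {| operation := shuffle_queue_op; step := rev_queue_step;
     admissible := sorted not_both_shuffle |}.

(* Main.v *)
Require Import Defs.
From mathcomp Require Import all_boot all_fingroup.
From mathcomp Require Import classical_sets.

(** A shuffle queue is a deque that can be read from either side: reversing the
    queue amounts to exchanging the roles of the two ends.  Throughout, the
    content of the queue is the content of the deque either as it stands or
    reversed, and a boolean records which.  Seen through a suitable
    orientation, every deque operation is a push or a pop
    ([core_step_orient]).

    Hence a run of the queue is a run of the deque, where a shuffle does nothing
    except flip the recorded orientation ([deque_run_of_queue_run]).
    Conversely, a deque operation is performed on the queue by first shuffling
    if the orientation is wrong, and then pushing or popping
    ([queue_run_of_deque_run]).  Each such block ends with a push or a pop, so
    two shuffles are never adjacent; and if the content is too short to be
    shuffled, it is its own reverse and no shuffle is called for.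

    Both runs end with an empty device, which is its own reverse, so the two
    devices have the same possible outputs on every input word
    ([possible_output_Deq_Qrev]). *)

Definition orient (b : bool) (c : config) : config :=
  let: (inp, dev, out) := c in (inp, if b then rev dev else dev, out).

Lemma orientK b c : orient b (orient b c) = c.
Proof. by case: b c => [] [[inp dev] out]; rewrite /= ?revK. Qed.

(** Whether the deque must be read backwards for [a] to become an operation of
    the queue, which inserts at the back and removes at the front. *)
Definition backward (a : deque_op) : bool :=
  match a with PushBack | PopFront => false | PushFront | PopBack => true end.

Definition core (a : deque_op) : shuffle_queue_op :=
  match a with PushBack | PushFront => Push | PopFront | PopBack => Pop end.

(** Inserting at the front of a list, or removing its last element, is
    inserting at the back of its reverse, or removing the first element of its
    reverse. *)
Lemma core_step_orient a c :
  rev_queue_step (core a) (orient (backward a) c)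
  = omap (orient (backward a)) (deque_step a c).
Proof.
case: a c => [] [[[|x inp] [|y dev]] out] //=; rewrite ?rev_cons //.
all: by rewrite -rev_cons lastI rev_rcons.
Qed.

(** A content of length at most 1 cannot be shuffled, but equals its reverse:
    one optional shuffle always suffices to change the orientation. *)
Lemma reorient b b' c :
  exists k : bool,
    @run Qrev (nseq k Shuffle) (orient b c) = Some (orient b' c).
Proof.
have [<-|neq_b] := eqVneq b b'; first by exists false.
case: c => [[inp dev] out].
case: (leqP 2 (size dev)) => [long|short].
  exists true; case: b b' neq_b => [] [] //= _.
    by rewrite size_rev long revK.
  by rewrite long.
exists false; case: dev short => [|x [|y dev]] // _.
  by case: b b' {neq_b} => [] [].
by case: b b' {neq_b} => [] [].
Qed.

Lemma run_cat (D : device) (v w : seq (operation D)) c :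
  run (v ++ w) c = obind (run w) (run v c).
Proof. by elim: v c => [|a v IHv] c //=; case: (step a c). Qed.

(** The push or pop separates the optional shuffle from whatever [w] starts
    with, so blocks can be concatenated freely. *)
Lemma sorted_optional_shuffle (k : bool) a w :
  sorted not_both_shuffle w ->
  sorted not_both_shuffle (nseq k Shuffle ++ core a :: w).
Proof. by case: k a w => [] [] [|[] w]. Qed.

Lemma queue_run_of_deque_run v b c c' :
  @run Deq v c = Some c' ->
  exists w b', sorted not_both_shuffle w
            /\ @run Qrev w (orient b c) = Some (orient b' c').
Proof.
elim: v b c => [|a v IHv] b c /=; first by case=> ->; exists [::], b.
case Ea: (deque_step a c) => [d|] // /(IHv (backward a)) [w [b' [w_ok run_w]]].
have [k run_k] := reorient b (backward a) c.
exists (nseq k Shuffle ++ core a :: w), b'.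
split; first exact: sorted_optional_shuffle.
by rewrite (@run_cat Qrev) run_k /= core_step_orient Ea.
Qed.

(** For a given orientation, the queue's insertion and removal ends determine
    which deque operation a push or a pop stands for. *)
Lemma queue_opP b q :
  q = Shuffle \/ exists2 a, core a = q & backward a = b.
Proof.
case: q; [right | right | by left].
  by exists (if b then PushFront else PushBack); case: b.
by exists (if b then PopBack else PopFront); case: b.
Qed.

Lemma deque_run_of_queue_run w b c c' :
  @run Qrev w (orient b c) = Some c' ->
  exists v b', @run Deq v c = Some (orient b' c').
Proof.
elim: w b c => [|q w IHw] b c /=.
  by case=> <-; exists [::], b; rewrite orientK.
case: (queue_opP b q) => [->|[a <- <-]].
  (* The deque does nothing: the shuffle only flips the orientation. *)
  have shuffleE d : rev_queue_step Shuffle (orient b c) = Some d ->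
      d = orient (~~ b) c.
    case: c => [[inp dev] out] /=; case: ifP => // _ [<-].
    by case: b; rewrite ?revK.
  by case: (rev_queue_step _ _) shuffleE => // d /(_ _ erefl) -> /IHw.
rewrite core_step_orient; case Ea: (deque_step a c) => [d|] //=.
by case/IHw=> v [b' run_v]; exists (a :: v), b'; rewrite /= Ea.
Qed.

Lemma possible_output_Deq_Qrev u v :
  possible_output Deq u v <-> possible_output Qrev u v.
Proof.
split=> [[w [_ /(queue_run_of_deque_run _ false) [w' [b [w'_ok run_w']]]]]
        |[w [_ run_w]]].
  by exists w'; split; last by case: b run_w'.
have [w' [b run_w']] := deque_run_of_queue_run _ false (u, [::], [::]) _ run_w.
by exists w'; split; last by case: b run_w'.
Qed.

Theorem theorem2p3 (n : nat) (hn : 1 <= n) : sortable n Deq = sortable n Qrev.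
Proof. by apply/seteqP; split=> s /possible_output_Deq_Qrev. Qed.
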